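(* Let $k\ge 1$, let $U\subset\mathbb{R}^m$ be a domain, and let $f:U\times\mathbb{R}^m\to\mathcal{C}l_m$, $(x,u)\mapsto f(x,u)$, be continuously differentiable and such that for each fixed $x\in U$ the function $u\mapsto f(x,u)$ is a left monogenic polynomial homogeneous of degree $k-1$. Write $Q_{k,u}$ for the operator $Q_k$ in the variables $(x,u)$ and $Q_{k,w}$ for the operator $Q_k$ in the variables $(y,w)$. If $Q_{k,u}\,uf(x,u)=0$ for all $x\in U$, $u\in\mathbb{R}^m$, then $$Q_{k,w}\Big[G(y)\,\frac{ywy}{\|y\|^2}\,f\Big(y^{-1},\frac{ywy}{\|y\|^2}\Big)\Big]=0$$ for all $w\in\mathbb{R}^m$ and all $y\in\mathbb{R}^m\setminus\{0\}$ with $y^{-1}\in U$, where $G(y)=\dfrac{y}{\|y\|^m}$ (that is, under the substitution $x=y^{-1}$, $u=\dfrac{ywy}{\|y\|^2}$).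
   Context: Assume $m\ge 3$. $\mathcal{C}l_m$ is the real Clifford algebra generated by $\mathbb{R}^m$ with orthonormal basis $e_1,\dots,e_m$ and relations $e_ie_j+e_je_i=-2\delta_{ij}$; $\mathbb{R}^m$ is regarded as a subset of $\mathcal{C}l_m$, and products such as $ywy$ are Clifford products (so $ywy\in\mathbb{R}^m$ for $y,w\in\mathbb{R}^m$). For a nonzero vector $y$, $y^{-1}=-y/\|y\|^2$ is its inverse in $\mathcal{C}l_m$. The Dirac operator in a variable $x\in\mathbb{R}^m$ is $D_x=\sum_{i=1}^m e_i\partial_{x_i}$, acting by Clifford multiplication from the left. A $\mathcal{C}l_m$-valued function $p(u)$ is left monogenic if $D_up=0$. Let $\mathcal{H}_k$ be the space of $\mathcal{C}l_m$-valued harmonic polynomials in $u\in\mathbb{R}^m$ homogeneous of degree $k$, and $\mathcal{M}_k$ the space of $\mathcal{C}l_m$-valued left monogenic polynomials in $u$ homogeneous of degree $k$. One has the Almansi-Fischer decomposition $\mathcal{H}_k=\mathcal{M}_k\oplus u\mathcal{M}_{k-1}$, and $P_k:\mathcal{H}_k\to\mathcal{M}_k$ is the corresponding projection, given by $P_k=\frac{uD_u}{m+2k-2}+1$; thus $I-P_k$ is the projection onto $u\mathcal{M}_{k-1}$. The operator $Q_k$ acts on functions $h(x,u)$ with $h(x,\cdot)\in u\mathcal{M}_{k-1}$ for each $x$ (e.g. $h=uf$ with $f(x,\cdot)\in\mathcal{M}_{k-1}$) by $$Q_kh(x,u)=(I-P_k)D_xh(x,u)=\frac{-uD_u}{m+2k-2}D_xh(x,u).$$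 In the variables $(y,w)$ it is defined by the same formula with $x,u$ replaced by $y,w$. *)

(* Defs.v *)
From HB Require Import structures.
From mathcomp Require Import all_boot all_order all_algebra.
From mathcomp Require Import all_classical all_reals all_analysis.
From mathcomp Require mpoly.

Set Implicit Arguments.
Unset Strict Implicit.
Unset Printing Implicit Defensive.

Import Order.TTheory GRing.Theory Num.Theory.
Import numFieldNormedType.Exports.

Local Open Scope classical_set_scope.
Local Open Scope ring_scope.

(* The real Clifford algebra Cl_m is the 2^m-dimensional space with basis e_A,
   A ranging over the subsets of {0, ..., m-1}, where for
   A = {i_1 < ... < i_r} one thinks of e_A = e_(i_1) ... e_(i_r).  It is stored
   as row vectors indexed by the subsets (through enum_rank), so that it
   inherits the finite-dimensional normed space structure and the derivatives
   of the library apply to Cl_m-valued functions. *)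
Definition Cl (R : realType) (m : nat) : Type := 'rV[R]_#|{set 'I_m}|.

HB.instance Definition _ (R : realType) (m : nat) :=
  NormedModule.on (Cl R m).

Section Algebra.
Variables (R : realType) (m : nat).
Implicit Types (A B C : {set 'I_m}) (a b c : Cl R m) (u v x y w : 'rV[R]_m).

Definition symdiff A B : {set 'I_m} := (A :\: B) :|: (B :\: A).

(* Reordering e_A e_B costs one sign for each pair i > j, and the cancellation
   e_i e_i = -1 one for each i common to A and B. *)
Definition clsign A B : R :=
  (-1) ^+ (\sum_(i in A) \sum_(j in B) (j <= i)%N).

Definition coef c A : R := (c : 'rV[R]_#|{set 'I_m}|) 0 (enum_rank A).

Definition eb A : Cl R m := delta_mx 0 (enum_rank A) : 'rV[R]_#|{set 'I_m}|.

Definition clmul a b : Cl R m :=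
  \sum_A \sum_B (coef a A * coef b B * clsign A B) *: eb (symdiff A B).

Lemma coefP a b : (forall A, coef a A = coef b A) -> a = b.
Proof.
move=> h; apply/rowP => i; have := h (enum_val i).
by rewrite /coef enum_valK.
Qed.

Lemma coefD a b A : coef (a + b) A = coef a A + coef b A.
Proof. exact: mxE. Qed.

Lemma coefZ (l : R) a A : coef (l *: a) A = l * coef a A.
Proof. exact: mxE. Qed.

Lemma coef0 A : coef 0 A = 0.
Proof. exact: mxE. Qed.

Lemma coef_sum (I : Type) (r : seq I) (P : pred I) (F : I -> Cl R m) A :
  coef (\sum_(i <- r | P i) F i) A = \sum_(i <- r | P i) coef (F i) A.
Proof.
by elim/big_rec2: _ => [|i y1 y2 _ <-]; rewrite ?coef0 // coefD.
Qed.

Lemma coef_eb A B : coef (eb A) B = (B == A)%:R.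
Proof. by rewrite /coef /eb mxE eqxx /= (inj_eq enum_rank_inj). Qed.

Lemma eb_dec a : a = \sum_A coef a A *: eb A.
Proof.
apply: coefP => B; rewrite coef_sum (bigD1 B) //= coefZ coef_eb eqxx mulr1.
rewrite big1 ?addr0 // => A nAB; rewrite coefZ coef_eb eq_sym (negbTE nAB).
by rewrite mulr0.
Qed.

Lemma clmulDl : left_distributive clmul +%R.
Proof.
move=> a b c; rewrite /clmul -big_split /=; apply: eq_bigr => A _.
rewrite -big_split /=; apply: eq_bigr => B _.
by rewrite -scalerDl coefD !mulrDl.
Qed.

Lemma clmulDr : right_distributive clmul +%R.
Proof.
move=> a b c; rewrite /clmul -big_split /=; apply: eq_bigr => A _.
rewrite -big_split /=; apply: eq_bigr => B _.
by rewrite -scalerDl coefD mulrDr !mulrDl.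
Qed.

Lemma clmulZl (l : R) a b : clmul (l *: a) b = l *: clmul a b.
Proof.
rewrite /clmul scaler_sumr; apply: eq_bigr => A _.
rewrite scaler_sumr; apply: eq_bigr => B _.
by rewrite scalerA coefZ !mulrA.
Qed.

Lemma clmulZr (l : R) a b : clmul a (l *: b) = l *: clmul a b.
Proof.
rewrite /clmul scaler_sumr; apply: eq_bigr => A _.
rewrite scaler_sumr; apply: eq_bigr => B _.
by rewrite scalerA coefZ !mulrA (mulrC (coef a A)).
Qed.

Lemma clmul0l b : clmul 0 b = 0 :> Cl R m.
Proof. by have := clmulZl 0 0 b; rewrite !scale0r. Qed.

Lemma clmul0r b : clmul b 0 = 0.
Proof. by have := clmulZr 0 b 0; rewrite !scale0r. Qed.

Lemma clmul_suml (I : Type) (r : seq I) (P : pred I) (F : I -> Cl R m) b :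
  clmul (\sum_(i <- r | P i) F i) b = \sum_(i <- r | P i) clmul (F i) b.
Proof.
by elim/big_rec2: _ => [|i y1 y2 _ <-]; rewrite ?clmul0l // clmulDl.
Qed.

Lemma clmul_sumr (I : Type) (r : seq I) (P : pred I) (F : I -> Cl R m) b :
  clmul b (\sum_(i <- r | P i) F i) = \sum_(i <- r | P i) clmul b (F i).
Proof.
by elim/big_rec2: _ => [|i y1 y2 _ <-]; rewrite ?clmul0r // clmulDr.
Qed.

Lemma clmul_eb A B : clmul (eb A) (eb B) = clsign A B *: eb (symdiff A B).
Proof.
rewrite /clmul (bigD1 A) //= [X in _ + X]big1 => [|A' nA].
  rewrite addr0 (bigD1 B) //= [X in _ + X]big1 => [|B' nB].
    by rewrite addr0 !coef_eb !eqxx !mul1r.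
  by rewrite !coef_eb (negbTE nB) mulr0 mul0r scale0r.
by rewrite big1 // => B' _; rewrite coef_eb (negbTE nA) !mul0r scale0r.
Qed.

Lemma symdiffE A B i : (i \in symdiff A B) = (i \in A) (+) (i \in B).
Proof. by rewrite !inE; case: (i \in A); case: (i \in B). Qed.

Lemma symdiffA A B C : symdiff A (symdiff B C) = symdiff (symdiff A B) C.
Proof. by apply/setP => i; rewrite !symdiffE addbA. Qed.

Lemma signM_sum (P Q S : pred 'I_m) (F : 'I_m -> nat) :
    (forall i, S i = P i (+) Q i) ->
  (-1) ^+ (\sum_(i | S i) F i) =
  (-1) ^+ (\sum_(i | P i) F i) * (-1) ^+ (\sum_(i | Q i) F i) :> R.
Proof.
move=> h; rewrite !(big_mkcond P) !(big_mkcond Q) !(big_mkcond S) /=.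
rewrite -exprD -big_split /= -signr_odd -[RHS]signr_odd.
congr (_ ^+ (nat_of_bool _)).
elim/big_ind2: _ => // [x1 x2 y1 y2 hx hy|i _]; first by rewrite !oddD hx hy.
by rewrite h; case: (P i); case: (Q i); rewrite //= ?addn0 // oddD addbb.
Qed.

Lemma clsignDl A B C : clsign (symdiff A B) C = clsign A C * clsign B C.
Proof. by apply: signM_sum => i; exact: symdiffE. Qed.

Lemma clsignDr A B C : clsign A (symdiff B C) = clsign A B * clsign A C.
Proof.
have E X Y : clsign X Y =
    (-1) ^+ (\sum_(j in Y) \sum_(i in X) (j <= i)%N) :> R.
  by rewrite /clsign exchange_big.
rewrite !E; by apply: signM_sum => i; exact: symdiffE.
Qed.

Lemma clmulA : associative clmul.
Proof.
have H A B C : clmul (eb A) (clmul (eb B) (eb C)) =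
               clmul (clmul (eb A) (eb B)) (eb C).
  rewrite !clmul_eb clmulZl clmulZr !clmul_eb !scalerA symdiffA.
  by rewrite clsignDl clsignDr [RHS]/= !mulrA (mulrC (clsign B C)) mulrAC.
have HC A B c : clmul (eb A) (clmul (eb B) c) =
                clmul (clmul (eb A) (eb B)) c.
  rewrite (eb_dec c) (clmul_sumr _ _ _ (eb B)) (clmul_sumr _ _ _ (eb A)).
  rewrite (clmul_sumr _ _ _ (clmul _ _)); apply: eq_bigr => C _.
  by rewrite (clmulZr _ (eb B)) (clmulZr _ (eb A)) (clmulZr _ (clmul _ _)) H.
have HB A b c : clmul (eb A) (clmul b c) = clmul (clmul (eb A) b) c.
  rewrite (eb_dec b) (clmul_suml _ _ _ c) (clmul_sumr _ _ _ (eb A)).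
  rewrite (clmul_sumr _ _ _ (eb A)) (clmul_suml _ _ _ c).
  apply: eq_bigr => B _; rewrite (clmulZl _ _ c) (clmulZr _ (eb A)).
  by rewrite (clmulZr _ (eb A)) (clmulZl _ _ c) HC.
move=> a b c; rewrite (eb_dec a) (clmul_suml _ _ _ (clmul b c)) (clmul_suml _ _ _ b).
rewrite (clmul_suml _ _ _ c); apply: eq_bigr => A _.
by rewrite (clmulZl _ _ (clmul b c)) (clmulZl _ _ b) (clmulZl _ _ c) HB.
Qed.

Definition cl1 : Cl R m := eb finset.set0.

Lemma clmul1l : left_id cl1 clmul.
Proof.
move=> a; rewrite (eb_dec a) clmul_sumr; apply: eq_bigr => A _.
rewrite clmulZr clmul_eb /clsign big_set0 scale1r; congr (_ *: eb _).
by apply/setP => i; rewrite symdiffE inE.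
Qed.

Lemma clmul1r : right_id cl1 clmul.
Proof.
move=> a; rewrite (eb_dec a) clmul_suml; apply: eq_bigr => A _.
rewrite clmulZl clmul_eb /clsign big1 => [|i _]; last by rewrite big_set0.
rewrite scale1r; congr (_ *: eb _).
by apply/setP => i; rewrite symdiffE inE addbF.
Qed.

Lemma cl1_neq0 : cl1 != 0.
Proof.
apply/eqP => /(congr1 (coef^~ finset.set0)); rewrite coef_eb eqxx coef0.
by move/eqP; rewrite oner_eq0.
Qed.

End Algebra.

HB.instance Definition _ (R : realType) (m : nat) :=
  GRing.Zmodule_isNzRing.Build (Cl R m) (@clmulA R m) (@clmul1l R m)
    (@clmul1r R m) (@clmulDl R m) (@clmulDr R m) (@cl1_neq0 R m).

Fact cl_scalerAl (R : realType) (m : nat) (l : R) (a b : Cl R m) :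
  l *: (a * b) = (l *: a) * b.
Proof. by rewrite -[RHS]/(clmul (l *: a) b) clmulZl. Qed.

HB.instance Definition _ (R : realType) (m : nat) :=
  GRing.Lmodule_isLalgebra.Build R (Cl R m) (@cl_scalerAl R m).

Fact cl_scalerAr (R : realType) (m : nat) (l : R) (a b : Cl R m) :
  l *: (a * b) = a * (l *: b).
Proof. by rewrite -[RHS]/(clmul a (l *: b)) clmulZr. Qed.

HB.instance Definition _ (R : realType) (m : nat) :=
  GRing.Lalgebra_isAlgebra.Build R (Cl R m) (@cl_scalerAr R m).

Section Vectors.
Variables (R : realType) (m : nat).
Implicit Types (u v x y w : 'rV[R]_m).

Definition e (i : 'I_m) : Cl R m := eb R [set i].

Definition vec x : Cl R m := \sum_i x 0 i *: e i.

Definition vpart (a : Cl R m) : 'rV[R]_m := \row_i coef a [set i].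

Definition dotp x y : R := \sum_i x 0 i * y 0 i.

(* The library norm on 'rV[R]_m is the sup norm; ‖x‖ is the Euclidean one. *)
Definition enorm x : R := Num.sqrt (dotp x x).

Lemma e_eb (i : 'I_m) (A : {set 'I_m}) :
  (forall j, j \in A -> (i < j)%N) -> e i * eb R A = eb R (i |: A).
Proof.
move=> h; rewrite -[LHS]/(clmul _ _) clmul_eb /clsign big_set1.
rewrite big1 => [|j /h]; last by rewrite ltnNge => /negbTE ->.
rewrite scale1r; congr (eb _ _); apply/setP => j; rewrite symdiffE !inE.
by case: (eqVneq j i) => [->|//]; case iA: (i \in A) => //; have := h _ iA;
  rewrite ltnn.
Qed.

Lemma e_anticomm (i j : 'I_m) : e i * e j + e j * e i = (- 2 * (i == j)%:R)%:A.
Proof.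
rewrite -[e i * _]/(clmul _ _) -[e j * _]/(clmul _ _) !clmul_eb /clsign.
rewrite !big_set1; case: (eqVneq i j) => [->|nij].
  rewrite leqnn expr1 -scalerDl mulr1 opprD; congr (_ *: eb _ _).
  by apply/setP => l; rewrite symdiffE addbb inE.
have -> : symdiff [set j] [set i] = symdiff [set i] [set j].
  by apply/setP => l; rewrite !symdiffE addbC.
rewrite -scalerDl mulr0 scale0r.
by case: (ltngtP i j) nij => [||/val_inj->]; rewrite ?eqxx //=
  ?expr0 ?expr1 ?subrr ?addNr scale0r.
Qed.

Lemma vecD u v : vec (u + v) = vec u + vec v.
Proof.
by rewrite /vec -big_split /=; apply: eq_bigr => i _; rewrite mxE scalerDl.
Qed.

Lemma vecZ (l : R) u : vec (l *: u) = l *: vec u.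
Proof.
by rewrite /vec scaler_sumr; apply: eq_bigr => i _; rewrite mxE scalerA.
Qed.

Lemma vec_anticomm u v : vec u * vec v + vec v * vec u = (- 2 * dotp u v)%:A.
Proof.
have E x y : vec x * vec y =
    \sum_i \sum_j (x 0 i * y 0 j) *: (e i * e j).
  rewrite /vec mulr_suml; apply: eq_bigr => i _.
  rewrite mulr_sumr; apply: eq_bigr => j _.
  by rewrite -scalerAl -scalerAr scalerA.
rewrite !E [X in _ + X]exchange_big -big_split /= /dotp mulr_sumr scaler_suml.
apply: eq_bigr => i _; rewrite -big_split /= (bigD1 i) //= big1 ?addr0.
  rewrite (mulrC (v 0 i)) -scalerDr e_anticomm eqxx mulr1 scalerA.
  by rewrite (mulrC (- 2)).
move=> j nji; rewrite (mulrC (v 0 j)) -scalerDr e_anticomm eq_sym.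
by rewrite (negbTE nji) mulr0 scale0r scaler0.
Qed.

Lemma vpartK : cancel vec vpart.
Proof.
move=> x; apply/rowP => i; rewrite mxE /vec coef_sum (bigD1 i) //= coefZ.
rewrite coef_eb eqxx mulr1 big1 ?addr0 // => j nji.
by rewrite coefZ coef_eb (inj_eq set1_inj) eq_sym (negbTE nji) mulr0.
Qed.

Lemma dotp_ge0 x : 0 <= dotp x x.
Proof. by apply: sumr_ge0 => i _; rewrite -expr2 sqr_ge0. Qed.

Lemma enorm_sqr x : enorm x ^+ 2 = dotp x x.
Proof. by rewrite sqr_sqrtr // dotp_ge0. Qed.

Lemma dotp_eq0 x : (dotp x x == 0) = (x == 0).
Proof.
apply/idP/eqP => [|->]; last by apply/eqP/big1 => i _; rewrite mxE mulr0.
rewrite psumr_eq0 => [/allP h|i _]; last by rewrite -expr2 sqr_ge0.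
apply/rowP => i; have := h i (mem_index_enum _).
by rewrite mulf_eq0 orbb mxE => /eqP.
Qed.

Lemma vec_sqr x : vec x * vec x = (- enorm x ^+ 2)%:A.
Proof.
have n2 : (2 : R) != 0 by rewrite pnatr_eq0.
apply: (scalerI n2); rewrite [LHS]scaler_nat mulr2n vec_anticomm scalerA.
by rewrite enorm_sqr mulrN mulNr.
Qed.

Definition vinv y : 'rV[R]_m := - (enorm y ^+ 2)^-1 *: y.

Lemma vinvP y : y != 0 -> vec y * vec (vinv y) = 1 /\ vec (vinv y) * vec y = 1.
Proof.
rewrite -dotp_eq0 -enorm_sqr => ny.
rewrite vecZ -scalerAr -scalerAl vec_sqr scalerA mulrNN mulVf //.
by rewrite scale1r.
Qed.

(* ywy/‖y‖^2 as a vector; vec_sandwich shows that taking the vector part of the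
   Clifford product loses nothing. *)
Definition sandwich y w : 'rV[R]_m :=
  vpart ((enorm y ^+ 2)^-1 *: (vec y * vec w * vec y)).

Lemma vec_sandwich y w :
  vec (sandwich y w) = (enorm y ^+ 2)^-1 *: (vec y * vec w * vec y).
Proof.
have E : vec y * vec w * vec y =
    vec ((- 2 * dotp y w) *: y + enorm y ^+ 2 *: w).
  rewrite vecD !vecZ.
  have -> : vec y * vec w = (- 2 * dotp y w)%:A - vec w * vec y.
    by rewrite -vec_anticomm addrK.
  rewrite mulrBl -mulrA vec_sqr mulr_algl mulr_algr.
  by rewrite scaleNr opprK.
by rewrite /sandwich E -vecZ vpartK.
Qed.

Definition G y : Cl R m := (enorm y ^+ m)^-1 *: vec y.

End Vectors.

Section Operators.
Variables (R : realType) (m : nat).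

Definition is_domain (U : set 'rV[R]_m) : Prop :=
  [/\ open U, connected U & U !=set0].

(* C^1 on an open subset of a finite-dimensional space V: there, continuity of
   q |-> 'd g q v for each v is continuity of q |-> 'd g q. *)
Definition C1_on (V W : normedModType R) (O : set V) (g : V -> W) : Prop :=
  forall p, O p -> differentiable g p /\
    forall v, {for p, continuous (fun q => 'd g q v)}.

(* 'D_v g x is a junk value where g has no derivative; the operators below are
   only meaningful on differentiable functions. *)
Definition Dirac (g : 'rV[R]_m -> Cl R m) (x : 'rV[R]_m) : Cl R m :=
  \sum_i e R i * 'D_(delta_mx 0 i) g x.

Definition homog_poly (k : nat) (p : 'rV[R]_m -> Cl R m) : Prop :=
  exists q : mpoly.dhomog m (Cl R m) k,
    forall u, p u =
      mpoly.meval (fun i => (u 0 i)%:A) (mpoly.mpoly_of_dhomog q).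

Definition Mk (k : nat) (p : 'rV[R]_m -> Cl R m) : Prop :=
  homog_poly k p /\ forall u, Dirac p u = 0.

(* The projection formula, written for arbitrary functions of u; it is the
   Almansi-Fischer projection H_k -> M_k when g is in H_k. *)
Definition Pk (k : nat) (g : 'rV[R]_m -> Cl R m) (u : 'rV[R]_m) : Cl R m :=
  (m%:R + 2 * k%:R - 2)^-1 *: (vec u * Dirac g u) + g u.

Lemma Pk_id k p u : Mk k p -> Pk k p u = p u.
Proof. by case=> _ h; rewrite /Pk h mulr0 scaler0 add0r. Qed.

(* (I - P_k) acts in the second variable on D_x h. *)
Definition Qk (k : nat) (h : 'rV[R]_m -> 'rV[R]_m -> Cl R m)
    (x u : 'rV[R]_m) : Cl R m :=
  let Dh := fun v => Dirac (fun z => h z v) x in Dh u - Pk k Dh u.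

Lemma QkE k h x u :
  Qk k h x u = - ((m%:R + 2 * k%:R - 2)^-1 *:
    (vec u * Dirac (fun v => Dirac (fun z => h z v) x) u)).
Proof. by rewrite /Qk /Pk opprD addrCA subrr addr0. Qed.

End Operators.

(* Main.v *)
Require Import Defs.
From HB Require Import structures.
From mathcomp Require Import all_boot all_order all_algebra.
From mathcomp Require Import all_classical all_reals all_analysis.
From mathcomp Require mpoly.
From mathcomp Require Import ring zify.

(** Why the theorem holds.  Write d = k - 1, x = y^-1, rho = |y|^2 and
    R w = y w y / rho = w - 2 <y, w> y / rho, the reflection in the hyperplane
    orthogonal to y.

    The first step replaces Q_k by a Rarita-Schwinger operator.  If every
    derivative of f in x is monogenic and homogeneous of degree d in u, then
    the anticommutation rules and Euler's identity give
    [D_u D_x (u f) = (m + 2 k - 4) D_x f + u D_u D_x f],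
    so Q_k (u f) is, up to a nonzero scalar, u times the right-hand side
    (Dirac_Dirac_vec).  Denote the right-hand side by S f.  As
    G(y) R w = - w G(y), the transformed function is - w g(y, w) with
    g(y, w) = G(y) f (y^-1, R w), so it suffices to compare S g with S f.

    The comparison is a chain rule computation.  The derivative of y^-1 in the
    direction v is - R v / rho, and that of R w is
    - 2 (<v, w> y + <y, w> R v) / rho.  Moreover e_i y = - y R(e_i), and since
    R is a symmetric involution, sums over the e_i may be taken over the R(e_i)
    instead (sum_reflect).  As D_y G = 0 and f is monogenic in u, this yields
    [D_y g = |y|^-m rho^-1 y (D_x f + 2 u <y, d_u> f)] at u = R w
    (Dirac_kelvin).  A second use of the same rules, together with the fact
    that <y, d_u> f is again monogenic, of degree d - 1, makes the terms in
    <y, d_u> f cancel: S g (y, w) = |y|^-m rho^-1 y (S f) (x, R w)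
    (rarita_schwinger_kelvin).  For w <> 0 the hypothesis gives S f = 0 at
    (x, R w), because R w is then invertible; for w = 0 the factor w kills
    everything.

    The analytic point is that f is only C^1, while D_u D_x f is a second
    derivative.  For fixed x the map f (x, .) is a homogeneous polynomial of
    degree d, hence is determined by its values on a finite grid through
    fixed Lagrange weights (grid_interp): near x, f (z, u) is a sum of
    products of a polynomial in u and a function f (z, u_s) of z.  So the
    derivatives in z are polynomial in u, and inherit from f (z, .) both
    monogenicity and Euler's identity (monog_derive).  The same applies to g,
    since homogeneous polynomials are stable under linear substitutions. *)

Set Implicit Arguments.
Unset Strict Implicit.
Unset Printing Implicit Defensive.

Import Order.TTheory GRing.Theory Num.Theory.
Import numFieldNormedType.Exports.

Local Open Scope classical_set_scope.
Local Open Scope ring_scope.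

(** * Differentials of bilinear expressions *)

Section DifferentialCalculus.
Variables (R : realType) (V W : normedModType R).

Lemma is_diff_bilinear (X Y Z : normedModType R) (B : X -> Y -> Z)
    (f df : V -> X) (g dg : V -> Y) (x : V) :
  bilinear_for *:%R *:%R B -> continuous (fun p => B p.1 p.2) ->
  is_diff x f df -> is_diff x g dg ->
  is_diff x (fun z => B (f z) (g z)) (fun v => B (f x) (dg v) + B (df v) (g x)).
Proof.
move=> lB cB hf hg.
pose mB := bilinear_isBilinear.Build _ _ _ _ _ _ B lB.
pose BB : {bilinear X -> Y -> Z} := HB.pack B mB.
have hB : is_diff (f x, g x) (fun p => B p.1 p.2)
    (fun q => B (f x) q.2 + B q.1 (g x)).
  apply: DiffDef; first exact: (@differentiable_bilin _ _ _ _ BB).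
  exact: (@diff_bilin _ _ _ _ BB).
have hfg : is_diff x (fun z => (f z, g z)) (fun v => (df v, dg v)).
  exact: is_diff_pair.
exact: (@is_diff_comp _ _ _ _ _ _ _ _ _ hfg hB).
Qed.

Lemma is_diff_sum (I : Type) (r : seq I) (h dh : I -> V -> W) (x : V) :
  (forall i, is_diff x (h i) (dh i)) ->
  is_diff x (fun z => \sum_(i <- r) h i z) (fun v => \sum_(i <- r) dh i v).
Proof.
move=> hh; elim: r => [|i r IH].
  have -> : (fun z => \sum_(i <- [::]) h i z) = cst 0.
    by apply/funext => z; rewrite big_nil.
  apply: is_diff_eq; apply/funext => v; by rewrite big_nil.
have -> : (fun z => \sum_(j <- i :: r) h j z) =
          h i + (fun z => \sum_(j <- r) h j z).
  by apply/funext => z; rewrite big_cons.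
apply: is_diff_eq; apply/funext => v; by rewrite big_cons.
Qed.

Lemma is_diff_add (f df g dg : V -> W) (x : V) :
  is_diff x f df -> is_diff x g dg ->
  is_diff x (fun z => f z + g z) (fun v => df v + dg v).
Proof. exact: is_diffD. Qed.

Lemma is_diff_zscale (k : R) (f df : V -> W) (x : V) :
  is_diff x f df -> is_diff x (fun z => k *: f z) (fun v => k *: df v).
Proof. exact: is_diffZ. Qed.

Lemma is_diff_derive (f df : V -> W) (x v : V) :
  is_diff x f df -> 'D_v f x = df v.
Proof. by move=> [? <-]; rewrite deriveE. Qed.

Lemma is_diff_deriveP (f : V -> W) (x : V) :
  differentiable f x -> is_diff x f (fun v => 'D_v f x).
Proof.
by move=> df; apply: DiffDef => //; apply/funext => v; rewrite deriveE.
Qed.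

Lemma is_diff_scale (k dk : V -> R) (g dg : V -> W) (x : V) :
  is_diff x k dk -> is_diff x g dg ->
  is_diff x (fun z => k z *: g z) (fun v => k x *: dg v + dk v *: g x).
Proof.
apply: (@is_diff_bilinear R W W (fun a b => a *: b)).
  split=> [u'|u] a b c /=.
    by rewrite scalerDl scalerA.
  by rewrite scalerDr !scalerA mulrC.
exact: scale_continuous.
Qed.

End DifferentialCalculus.

Section CliffordCalculus.
Variables (R : realType) (m : nat) (V : normedModType R).

(** Clifford multiplication is bilinear; its continuity is read off the
    coordinates. *)
Lemma is_diff_clmul (f df g dg : V -> Cl R m) (x : V) :
  is_diff x f df -> is_diff x g dg ->
  is_diff x (fun z => f z * g z) (fun v => f x * dg v + df v * g x).
Proof.
apply: (@is_diff_bilinear R _ _ _ _ (fun a b : Cl R m => a * b)).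
  split=> [u'|u] a b c /=.
    by rewrite mulrDl scalerAl.
  by rewrite mulrDr scalerAr.
pose F A B (p : Cl R m * Cl R m) : Cl R m :=
  (coef p.1 A * coef p.2 B * clsign R A B) *: eb R (symdiff A B).
have cc A : continuous (fun c : Cl R m => coef c A).
  exact: coord_continuous.
have cF A B : continuous (F A B).
  move=> p; apply: cvgZr_tmp; apply: cvgM; last exact: cvg_cst.
  apply: cvgM.
    exact: (cvg_comp (fun q : Cl R m * Cl R m => q.1) (fun c => coef c A)
              cvg_fst (cc A p.1)).
  exact: (cvg_comp (fun q : Cl R m * Cl R m => q.2) (fun c => coef c B)
            cvg_snd (cc B p.2)).
move=> p; rewrite /continuous_at.
change ((\sum_A \sum_B F A B q) @[q --> p] --> \sum_A \sum_B F A B p).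
apply: cvg_big => [|A _]; first exact: add_continuous.
apply: cvg_big => [|B _]; [exact: add_continuous|exact: cF].
Qed.

Lemma is_diff_lmul (a : Cl R m) (g dg : V -> Cl R m) (x : V) :
  is_diff x g dg -> is_diff x (fun z => a * g z) (fun v => a * dg v).
Proof.
move=> hg.
have := is_diff_clmul (is_diff_cst a x) hg.
by move/is_diff_eq; apply; apply/funext => v; rewrite mul0r addr0.
Qed.

End CliffordCalculus.

(** * Clifford identities and the Dirac operator *)

Section DiracAlgebra.
Variables (R : realType) (m : nat).
Implicit Types (a b u v w x y : 'rV[R]_m) (Phi : 'rV[R]_m -> Cl R m).

Definition bvec (i : 'I_m) : 'rV[R]_m := delta_mx 0 i.

Lemma bvecE i j : bvec i 0 j = (j == i)%:R.
Proof. by rewrite mxE eqxx. Qed.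

Lemma vec_bvec i : vec (bvec i) = e R i.
Proof.
rewrite /vec (bigD1 i) //= bvecE eqxx scale1r big1 ?addr0 // => j nji.
by rewrite bvecE (negbTE nji) scale0r.
Qed.

Lemma sum_bvec u : u = \sum_i u 0 i *: bvec i.
Proof.
apply/rowP => j; rewrite summxE (bigD1 j) //= mxE bvecE eqxx mulr1 big1 ?addr0 //.
by move=> i nij; rewrite mxE bvecE eq_sym (negbTE nij) mulr0.
Qed.

Lemma linear_sum_bvec (W : lmodType R) (Phi : 'rV[R]_m -> W) u :
  linear Phi -> Phi u = \sum_i u 0 i *: Phi (bvec i).
Proof.
move=> hP.
pose mP := GRing.isLinear.Build _ _ _ _ _ hP.
pose P : {linear 'rV[R]_m -> W} := HB.pack Phi mP.
rewrite {1}(sum_bvec u) -[Phi]/(P : _ -> _) linear_sum; apply: eq_bigr => i _.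
by rewrite linearZ.
Qed.

Lemma dotpC u v : dotp u v = dotp v u.
Proof. by apply: eq_bigr => i _; rewrite mulrC. Qed.

Lemma dotp_bvec u i : dotp u (bvec i) = u 0 i.
Proof.
rewrite /dotp (bigD1 i) //= bvecE eqxx mulr1 big1 ?addr0 // => j nji.
by rewrite bvecE (negbTE nji) mulr0.
Qed.

Lemma vec_swap u v : vec u * vec v = - (vec v * vec u) - (2 * dotp u v)%:A.
Proof.
by rewrite -[vec u * _](addrK (vec v * vec u)) vec_anticomm mulNr scaleNr addrC.
Qed.

Lemma e_vec i u : e R i * vec u = - (vec u * e R i) - (2 * u 0 i)%:A.
Proof. by rewrite -vec_bvec vec_swap dotpC dotp_bvec. Qed.

Lemma e_sqr (i : 'I_m) : e R i * e R i = -1.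
Proof.
by rewrite -(vec_bvec i) vec_sqr enorm_sqr (dotp_bvec (bvec i)) bvecE eqxx scaleN1r.
Qed.

(** Moving a vector a to the left of all the e_i costs one anticommutator
    e_i a + a e_i = - 2 a_i for each i; these add up to the value of Phi at a. *)
Lemma sum_e_vec a Phi : linear Phi ->
  \sum_i e R i * (vec a * Phi (bvec i)) =
  - (vec a * \sum_i e R i * Phi (bvec i)) - 2 *: Phi a.
Proof.
move=> hP; rewrite [in RHS](linear_sum_bvec a hP) mulr_sumr scaler_sumr -!sumrN.
rewrite -big_split /=; apply: eq_bigr => i _.
by rewrite mulrA e_vec mulrBl mulNr -mulrA mulr_algl scalerA.
Qed.

End DiracAlgebra.

Section DiracCalculus.
Variables (R : realType) (m : nat).
Implicit Types (a b u v w x y : 'rV[R]_m) (p : 'rV[R]_m -> Cl R m).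

Lemma is_diff_linear (W : normedModType R) (df f : 'rV[R]_m -> W) x :
  is_diff x f df -> linear df.
Proof. by move=> [_ <-] l u v; rewrite linearP. Qed.

Lemma is_diff_coord (i : 'I_m) u :
  is_diff u (fun z : 'rV[R]_m => z 0 i) (fun v => v 0 i).
Proof.
pose f := fun N : 'rV[R]_m => N 0 i.
have lf : linear f by move=> l a b; rewrite /f !mxE.
pose mf := GRing.isLinear.Build _ _ _ _ _ lf.
pose F : {linear 'rV[R]_m -> R} := HB.pack f mf.
have cF : continuous F by exact: coord_continuous.
apply: DiffDef; first exact: (linear_differentiable (f := F)).
exact: (diff_lin (f := F)).
Qed.

Lemma is_diff_vec (V : normedModType R) (f df : V -> 'rV[R]_m) (t : V) :
  is_diff t f df -> is_diff t (fun z => vec (f z)) (fun dz => vec (df dz)).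
Proof.
move=> hf; apply: is_diff_sum => i.
have h : is_diff t (fun z => f z 0 i) (fun dz => df dz 0 i).
  exact: (is_diff_comp hf (is_diff_coord i (f t))).
have := is_diff_scale h (is_diff_cst (e R i) t).
by move/is_diff_eq; apply; apply/funext => v; rewrite scaler0 add0r.
Qed.

Lemma Dirac_is_diff p dp x : is_diff x p dp ->
  Dirac p x = \sum_i e R i * dp (bvec R i).
Proof. by move=> hp; apply: eq_bigr => i _; rewrite (is_diff_derive _ hp). Qed.

(** The product rule gives sum_i e_i e_i p = - m p, and sum_e_vec turns the
    remaining terms into u D p and the Euler term 'D_u p u. *)
Lemma Dirac_vec_mul p u : differentiable p u ->
  Dirac (fun z => vec z * p z) u =
  - (m%:R *: p u) - vec u * Dirac p u - 2 *: 'D_u p u.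
Proof.
move=> /is_diff_deriveP hp.
rewrite (Dirac_is_diff (is_diff_clmul (is_diff_vec (is_diff_id u)) hp)).
rewrite (eq_bigr (fun i => e R i * (vec u * 'D_(bvec R i) p u) - p u)); last first.
  by move=> i _; rewrite mulrDr vec_bvec [in X in _ + X]mulrA e_sqr mulN1r.
rewrite big_split /= (sum_e_vec u (is_diff_linear hp)) sumr_const card_ord.
by rewrite mulNrn -(scaler_nat m (p u)) addrC addrA.
Qed.

End DiracCalculus.

(** * Homogeneous polynomial maps *)

Section HomogeneousPolynomials.
Variables (R : realType) (m : nat).
Implicit Types (a b u v w x y : 'rV[R]_m) (p q : 'rV[R]_m -> Cl R m).

(** Homogeneous polynomial maps, generated so that each of their properties
    follows by induction. *)
Inductive hpoly : nat -> ('rV[R]_m -> Cl R m) -> Prop :=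
| hpoly0 d : hpoly d (fun=> 0)
| hpolyC c : hpoly 0 (fun=> c)
| hpolyD d p q : hpoly d p -> hpoly d q -> hpoly d (fun u => p u + q u)
| hpolyX d (i : 'I_m) p : hpoly d p -> hpoly d.+1 (fun u => u 0 i *: p u).

Lemma hpoly_sum d (I : Type) (r : seq I) (P : pred I) F :
  all P r -> (forall i, P i -> hpoly d (F i)) ->
  hpoly d (fun u => \sum_(i <- r) F i u).
Proof.
move=> + hF; elim: r => [_|i r IH /= /andP[Pi /IH{}IH]].
  rewrite [X in hpoly _ X](_ : _ = fun=> 0); first exact: hpoly0.
  by apply/funext => u; rewrite big_nil.
rewrite [X in hpoly _ X](_ : _ = fun u => F i u + \sum_(j <- r) F j u).
  by apply: hpolyD IH; exact: hF.
by apply/funext => u; rewrite big_cons.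
Qed.

Lemma hpolyMl d c p : hpoly d p -> hpoly d (fun u => c * p u).
Proof.
elim=> {d p} [d|c'|d p q _ hp _ hq|d i p _ hp].
- under eq_fun do rewrite mulr0; exact: hpoly0.
- exact: hpolyC.
- under eq_fun do rewrite mulrDr; exact: hpolyD.
- under eq_fun do rewrite -scalerAr; exact: hpolyX.
Qed.

Lemma hpolyZ d (l : R) p : hpoly d p -> hpoly d (fun u => l *: p u).
Proof.
move=> h; under eq_fun do rewrite -mulr_algl; exact: hpolyMl.
Qed.

(** A coordinate of S u is a linear combination of the coordinates of u, so
    the multiplication rule survives the substitution. *)
Lemma hpoly_lin d (S : 'rV[R]_m -> 'rV[R]_m) p :
  linear S -> hpoly d p -> hpoly d (fun u => p (S u)).
Proof.
move=> hS; elim=> {d p} [d|c'|d p q _ hp _ hq|d i p _ hp].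
- exact: hpoly0.
- exact: hpolyC.
- exact: hpolyD.
- have -> : (fun u => S u 0 i *: p (S u)) =
      (fun u => \sum_j u 0 j *: (S (bvec R j) 0 i *: p (S u))).
    apply/funext => u; rewrite {1}(linear_sum_bvec u hS) summxE scaler_suml.
    by apply: eq_bigr => j _; rewrite mxE scalerA.
  by apply: (hpoly_sum (all_predT _)) => j _; apply: hpolyX; exact: hpolyZ.
Qed.

Lemma hpoly_monomial (r : seq 'I_m) (al : 'I_m -> nat) c :
  hpoly (\sum_(i <- r) al i) (fun u => (\prod_(i <- r) u 0 i ^+ al i) *: c).
Proof.
elim: r => [|i r IH].
  rewrite big_nil [X in hpoly _ X](_ : _ = fun=> c); first exact: hpolyC.
  by apply/funext => u; rewrite big_nil scale1r.
rewrite big_cons; set n := al i; set s := (X in (n + X)%N).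
rewrite [X in hpoly _ X](_ : _ =
  fun u => u 0 i ^+ n *: ((\prod_(j <- r) u 0 j ^+ al j) *: c)); last first.
  by apply/funext => u; rewrite big_cons scalerA.
elim: n => [|n IHn].
  rewrite [X in hpoly _ X](_ : _ =
    fun u => (\prod_(j <- r) u 0 j ^+ al j) *: c) //.
  by apply/funext => u; rewrite expr0 scale1r.
rewrite [X in hpoly _ X](_ : _ = fun u =>
  u 0 i *: (u 0 i ^+ n *: ((\prod_(j <- r) u 0 j ^+ al j) *: c))).
  exact: hpolyX.
by apply/funext => u; rewrite exprS -scalerA.
Qed.

Lemma homog_poly_hpoly d p : homog_poly d p -> hpoly d p.
Proof.
move=> [q hq].
have -> : p = fun u => \sum_(al <- mpoly.msupp (mpoly.mpoly_of_dhomog q))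
    mpoly.mcoeff al (mpoly.mpoly_of_dhomog q) *
      ((\prod_i u 0 i ^+ mpoly.fun_of_multinom al i) *: 1).
  apply/funext => u; rewrite hq mpoly.mevalE; apply: eq_bigr => al _.
  congr (_ * _); rewrite -[RHS]/(GRing.in_alg (Cl R m)
    (\prod_i u 0 i ^+ mpoly.fun_of_multinom al i)) rmorph_prod /=.
  by apply: eq_bigr => i _; rewrite -[RHS]/(GRing.in_alg (Cl R m) _) rmorphXn.
have := mpoly.dhomog_is_dhomog q; rewrite mpoly.dhomogE => hd.
apply: (hpoly_sum hd) => al /eqP hal; apply: hpolyMl.
have <- : (\sum_i mpoly.fun_of_multinom al i)%N = d by rewrite -mpoly.mdegE.
exact: hpoly_monomial.
Qed.

(** What is needed of the first two derivatives of a homogeneous polynomial of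
    degree d; bundled because one induction proves everything.  The last field
    is Euler's identity for the derivative, stated with d - 1 in R so that it
    also holds for d = 0, where the derivative vanishes. *)
Record hpoly_calculus (d : nat) p : Prop := HPolyCalculus {
  hpoly_diff : forall u, differentiable p u;
  hpoly_diff_derive : forall v u, differentiable (fun z => 'D_v p z) u;
  hpoly_derive_comm : forall v w u,
    'D_w (fun z => 'D_v p z) u = 'D_v (fun z => 'D_w p z) u;
  hpoly_euler : forall u, 'D_u p u = d%:R *: p u;
  hpoly_derive_euler : forall v u,
    'D_u (fun z => 'D_v p z) u = (d%:R - 1) *: 'D_v p u }.

Lemma hpoly_calculusP d p : hpoly d p -> hpoly_calculus d p.
Proof.
elim=> {d p} [d|c|d p q _ hp _ hq|d i p _ hp].
- have E (v : 'rV[R]_m) : (fun z => 'D_v (fun=> 0 : Cl R m) z) = fun=> 0.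
    by apply/funext => z; exact: derive_cst.
  split=> [u|v u|v w u|u|v u]; rewrite ?E.
  + exact: differentiable_cst.
  + exact: differentiable_cst.
  + by [].
  + by rewrite derive_cst scaler0.
  + by rewrite !derive_cst scaler0.
- have E (v : 'rV[R]_m) : (fun z => 'D_v (fun=> c : Cl R m) z) = fun=> 0.
    by apply/funext => z; exact: derive_cst.
  split=> [u|v u|v w u|u|v u]; rewrite ?E.
  + exact: differentiable_cst.
  + exact: differentiable_cst.
  + by [].
  + by rewrite derive_cst scale0r.
  + by rewrite !derive_cst scaler0.
- have h1 u := is_diff_add (is_diff_deriveP (hpoly_diff hp u))
                           (is_diff_deriveP (hpoly_diff hq u)).
  have h1E v u : 'D_v (fun u => p u + q u) u = 'D_v p u + 'D_v q u.
    exact: (is_diff_derive v (h1 u)).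
  have h2 v u := is_diff_add (is_diff_deriveP (hpoly_diff_derive hp v u))
                             (is_diff_deriveP (hpoly_diff_derive hq v u)).
  have E v : (fun z => 'D_v (fun u => p u + q u) z) =
      (fun z => 'D_v p z + 'D_v q z).
    by apply/funext => z; exact: h1E.
  have h2E v w u : 'D_w (fun z => 'D_v (fun u => p u + q u) z) u =
      'D_w (fun z => 'D_v p z) u + 'D_w (fun z => 'D_v q z) u.
    by rewrite E; exact: (is_diff_derive w (h2 v u)).
  split=> [u|v u|v w u|u|v u].
  + by case: (h1 u).
  + by rewrite E; case: (h2 v u).
  + apply: etrans (h2E v w u) _; apply: etrans _ (esym (h2E w v u)).
    exact: (f_equal2 +%R (hpoly_derive_comm hp v w u) (hpoly_derive_comm hq v w u)).
  + apply: etrans (h1E u u) _.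
    by rewrite scalerDr; congr (_ + _); [exact: (hpoly_euler hp u)|exact: (hpoly_euler hq u)].
  + apply: etrans (h2E v u u) _; rewrite (h1E v u) scalerDr.
    by congr (_ + _);
      [exact: (hpoly_derive_euler hp v u)|exact: (hpoly_derive_euler hq v u)].
- have h1 u := is_diff_scale (is_diff_coord i u) (is_diff_deriveP (hpoly_diff hp u)).
  have h1E v u : 'D_v (fun u => u 0 i *: p u) u =
      u 0 i *: 'D_v p u + v 0 i *: p u.
    exact: (is_diff_derive v (h1 u)).
  have h2 v u := is_diff_add (is_diff_scale (is_diff_coord i u)
                            (is_diff_deriveP (hpoly_diff_derive hp v u)))
                   (is_diff_zscale (v 0 i) (is_diff_deriveP (hpoly_diff hp u))).
  have E v : (fun z => 'D_v (fun u => u 0 i *: p u) z) =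
      (fun z => z 0 i *: 'D_v p z + v 0 i *: p z).
    by apply/funext => z; exact: h1E.
  have h2E v w u : 'D_w (fun z => 'D_v (fun u => u 0 i *: p u) z) u =
      (u 0 i *: 'D_w (fun z => 'D_v p z) u + w 0 i *: 'D_v p u) +
      v 0 i *: 'D_w p u.
    by rewrite E; exact: (is_diff_derive w (h2 v u)).
  have dS : d.+1%:R = d%:R + 1 :> R by rewrite -addn1 natrD.
  split=> [u|v u|v w u|u|v u].
  + by case: (h1 u).
  + by rewrite E; case: (h2 v u).
  + apply: etrans (h2E v w u) _; apply: etrans _ (esym (h2E w v u)).
    rewrite -!addrA; apply: (f_equal2 +%R); last exact: addrC.
    exact: (f_equal ( *:%R (u 0 i)) (hpoly_derive_comm hp v w u)).
  + apply: etrans (h1E u u) _.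
    have -> := hpoly_euler hp u.
    by rewrite dS scalerDl scale1r !scalerA mulrC.
  + apply: etrans (h2E v u u) _.
    have -> := hpoly_derive_euler hp v u; have -> := hpoly_euler hp u.
    rewrite (h1E v u) dS addrK scalerDr !scalerA -scalerDl mulrBr mulr1 subrK.
    by congr (_ *: _ + _ *: _); exact: mulrC.
Qed.

End HomogeneousPolynomials.

(** * Interpolation and monogenic families *)

Section Interpolation.
Variables (R : realType) (m : nat).
Implicit Types (a b u v w x y : 'rV[R]_m) (p q : 'rV[R]_m -> Cl R m).

Local Notation grid d := {ffun 'I_m -> 'I_d.+1}.

Definition grid_pt d (s : grid d) : 'rV[R]_m := \row_i (s i : nat)%:R.

Definition lagrange_node d (j : 'I_d.+1) : {poly R} :=
  tnth (lagrange d.+1 (fun n : nat => n%:R : R)) j.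

Definition grid_weight d (s : grid d) u : R := \prod_i (lagrange_node (s i)).[u 0 i].

Lemma lagrange_node_exp d n (t : R) : (n <= d)%N ->
  t ^+ n = \sum_(j < d.+1) (j : nat)%:R ^+ n * (lagrange_node j).[t].
Proof.
move=> hn.
have inj : injective (fun n : nat => n%:R : R).
  by move=> i j /eqP; rewrite eqr_nat => /eqP.
have := @lagrange_gen R d.+1 _ (ltn0Sn d) inj ('X^n).
rewrite size_polyXn ltnS => /(_ hn) /(congr1 (fun p : {poly R} => p.[t])).
rewrite hornerXn => ->; rewrite horner_sum; apply: eq_bigr => j _.
by rewrite hornerM hornerC hornerXn.
Qed.

Lemma grid_weight_monomial d (al : 'I_m -> nat) u : (forall i, (al i <= d)%N) ->
  \prod_i u 0 i ^+ al i =
  \sum_(s : grid d) grid_weight s u * \prod_i grid_pt s 0 i ^+ al i.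
Proof.
move=> hal.
rewrite (eq_bigr (fun i => \sum_(j < d.+1) (j : nat)%:R ^+ al i * (lagrange_node j).[u 0 i])).
  rewrite bigA_distr_bigA; apply: eq_bigr => s _.
  rewrite /grid_weight -big_split; apply: eq_bigr => i _.
  by rewrite mxE mulrC.
by move=> i _; exact: lagrange_node_exp.
Qed.

(** Lagrange interpolation in each variable separately is exact on monomials
    with exponents at most d.  The induction on p carries an extra monomial
    factor, which absorbs the coordinates one at a time. *)
Lemma grid_interp d p u : hpoly d p ->
  p u = \sum_(s : grid d) grid_weight s u *: p (grid_pt s).
Proof.
suff H d' q : hpoly d' q -> forall al : 'I_m -> nat,
    (forall i, (al i + d' <= d)%N) ->
    (\prod_i u 0 i ^+ al i) *: q u =
    \sum_(s : grid d) grid_weight s u *: ((\prod_i grid_pt s 0 i ^+ al i) *: q (grid_pt s)).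
  move=> /H /(_ (fun=> 0) (fun=> leqnn _)).
  rewrite big1 // scale1r => ->; apply: eq_bigr => s _.
  by rewrite scale1r.
elim=> {d' q} [d' al _|c al hal|d' p1 p2 _ h1 _ h2 al hal|d' i q _ hq al hal].
- by rewrite scaler0 big1 // => s _; rewrite !scaler0.
- rewrite (@grid_weight_monomial d) => [|i]; last by rewrite -[al i]addn0.
  by rewrite scaler_suml; apply: eq_bigr => s _; rewrite scalerA.
- rewrite scalerDr h1 // h2 // -big_split /=.
  by apply: eq_bigr => s _; rewrite !scalerDr.
(* The coordinate u_i moves from the polynomial into the extra monomial. *)
- pose be j := (al j + (j == i))%N.
  have E v : (\prod_j v 0 j ^+ be j) = (\prod_j v 0 j ^+ al j) * v 0 i.
    rewrite (eq_bigr (fun j => v 0 j ^+ al j * (if j == i then v 0 i else 1))).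
      rewrite big_split /= -big_mkcond; congr (_ * _).
      by rewrite (big_pred1 i).
    by move=> j _; rewrite /be exprD; case: eqVneq => [->|_].
  have hbe j : (be j + d' <= d)%N.
    by apply: leq_trans (hal j); rewrite addnS /be; case: (j == i); lia.
  rewrite scalerA -E (hq be hbe); apply: eq_bigr => s _.
  by rewrite !scalerA E mulrA.
Qed.

Lemma grid_weight_diff d (s : grid d) u : differentiable (grid_weight s) u.
Proof.
have H (r : seq 'I_m) :
    differentiable (fun v : 'rV[R]_m => \prod_(i <- r) (lagrange_node (s i)).[v 0 i]) u.
  elim: r => [|i r IH].
    rewrite [X in differentiable X _](_ : _ = cst 1); first exact: differentiable_cst.
    by apply/funext => v; rewrite big_nil.
  rewrite [X in differentiable X _](_ : _ = (horner (lagrange_node (s i)) \o (fun v => v 0 i)) *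
     (fun v : 'rV[R]_m => \prod_(i <- r) (lagrange_node (s i)).[v 0 i])).
    apply: differentiableM IH; apply: differentiable_comp.
      by case: (is_diff_coord i u).
    apply/derivable1_diffP; exact: derivable_horner.
  by apply/funext => v; rewrite big_cons.
exact: H.
Qed.

(** The consequences of p being monogenic and homogeneous of degree d that the
    Clifford computations use. *)
Record monog (d : nat) p : Prop := Monog {
  monog_diff : forall u, differentiable p u;
  monog_Dirac : forall u, Dirac p u = 0;
  monog_euler : forall u, 'D_u p u = d%:R *: p u }.

(** Interpolation writes f z u as a combination of the f z (grid_pt s) with
    weights depending on u alone.  So the derivative of f in z is the same
    combination of the derivatives of the f z (grid_pt s); being annihilated by
    D, or satisfying Euler's identity, is a linear relation between the values
    f z (grid_pt s), valid for all z near x, and can be differentiated in z. *)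
Lemma monog_derive d (f : 'rV[R]_m -> 'rV[R]_m -> Cl R m) x a :
  (\forall z \near x, hpoly d (f z) /\ forall u, Dirac (f z) u = 0) ->
  (forall u, differentiable (f^~ u) x) ->
  monog d (fun u => 'D_a (f^~ u) x).
Proof.
move=> hf hd.
pose b (s : grid d) := 'D_a (f^~ (grid_pt s)) x.
have comb (c : grid d -> Cl R m) :
    is_diff x (fun z => \sum_s c s * f z (grid_pt s))
              (fun v => \sum_s c s * 'D_v (f^~ (grid_pt s)) x).
  apply: is_diff_sum => s; apply: is_diff_lmul.
  exact: (is_diff_deriveP (hd (grid_pt s))).
have pE u : 'D_a (f^~ u) x = \sum_s grid_weight s u *: b s.
  have hc := is_diff_derive a (comb (fun s => (grid_weight s u)%:A)).
  have -> : \sum_s grid_weight s u *: b s = \sum_s (grid_weight s u)%:A * b s.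
    by apply: eq_bigr => s _; rewrite mulr_algl.
  apply: etrans _ hc; apply: near_eq_derive.
  apply: filterS hf => z [hz _].
  rewrite (grid_interp u hz); apply: eq_bigr => s _; by rewrite mulr_algl.
have rel0 (c : grid d -> Cl R m) :
    (\forall z \near x, \sum_s c s * f z (grid_pt s) = 0) ->
    \sum_s c s * b s = 0.
  move=> hc; apply: etrans (esym (is_diff_derive a (comb c))) _.
  apply: etrans (near_eq_derive a (g := cst 0) hc) _; exact: derive_cst.
have isp (B : grid d -> Cl R m) u :
    is_diff u (fun u => \sum_s grid_weight s u *: B s)
              (fun v => \sum_s 'D_v (grid_weight s) u *: B s).
  apply: is_diff_sum => s.
  have := is_diff_scale (is_diff_deriveP (grid_weight_diff s u)) (is_diff_cst (B s) u).
  by move/is_diff_eq; apply; apply/funext => v; rewrite scaler0 add0r.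
have fE z : hpoly d (f z) -> f z = (fun u => \sum_(s : grid d) grid_weight s u *: f z (grid_pt s)).
  by move=> hz; apply/funext => u; exact: (grid_interp u hz).
rewrite (funext pE); split=> u.
- by case: (isp b u).
- apply: etrans (Dirac_is_diff (isp b u)) _.
  pose c (s : grid d) : Cl R m := \sum_i 'D_(bvec R i) (grid_weight s) u *: e R i.
  have E (B : grid d -> Cl R m) :
     \sum_i e R i * (\sum_s 'D_(bvec R i) (grid_weight s) u *: B s) = \sum_s c s * B s.
    under eq_bigr do rewrite mulr_sumr.
    rewrite exchange_big; apply: eq_bigr => s _; rewrite mulr_suml.
    by apply: eq_bigr => i _; rewrite -scalerAl -scalerAr.
  apply: etrans (E b) _; apply: rel0; apply: filterS hf => z [hz hz0].
  apply: etrans (esym (E _)) _.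
  apply: etrans (esym (Dirac_is_diff (isp _ u))) _.
  by rewrite -(fE _ hz).
- apply: etrans (is_diff_derive u (isp b u)) _.
  apply/eqP; rewrite -subr_eq0; apply/eqP.
  pose c (s : grid d) : Cl R m := ('D_u (grid_weight s) u - d%:R * grid_weight s u)%:A.
  have E (B : grid d -> Cl R m) : \sum_s 'D_u (grid_weight s) u *: B s -
      d%:R *: (\sum_s grid_weight s u *: B s) = \sum_s c s * B s.
    rewrite scaler_sumr -sumrB; apply: eq_bigr => s _.
    by rewrite mulr_algl scalerBl scalerA.
  apply: etrans (E b) _; apply: rel0; apply: filterS hf => z [hz _].
  apply: etrans (esym (E _)) _.
  rewrite -(is_diff_derive u (isp _ u)) -(fE _ hz) -(grid_interp u hz).
  by apply/eqP; rewrite subr_eq0; apply/eqP/(hpoly_euler (hpoly_calculusP hz)).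
Qed.

End Interpolation.

(** * Dirac operator of monogenic families *)

Section DiracFamilies.
Variables (R : realType) (m : nat).
Implicit Types (a b u v w x y : 'rV[R]_m) (p q : 'rV[R]_m -> Cl R m).

Lemma is_diff_sum_e (h dh : 'I_m -> 'rV[R]_m -> Cl R m) u :
  (forall i, is_diff u (h i) (dh i)) ->
  is_diff u (fun z => \sum_i e R i * h i z) (fun v => \sum_i e R i * dh i v).
Proof. by move=> hh; apply: is_diff_sum => i; exact: is_diff_lmul. Qed.

(** This is sum_e_vec with a = e_i, applied to each h_i. *)
Lemma Dirac_sum_e (h dh : 'I_m -> 'rV[R]_m -> Cl R m) u :
  (forall i, is_diff u (h i) (dh i)) ->
  Dirac (fun z => \sum_i e R i * h i z) u =
  - (\sum_i e R i * Dirac (h i) u) - 2 *: \sum_i dh i (bvec R i).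
Proof.
move=> hh; apply: etrans (Dirac_is_diff (is_diff_sum_e hh)) _.
under eq_bigr do rewrite mulr_sumr.
rewrite exchange_big scaler_sumr -!sumrN -big_split; apply: eq_bigr => i _ /=.
have := sum_e_vec (bvec R i) (is_diff_linear (hh i)).
by rewrite vec_bvec => ->; rewrite (Dirac_is_diff (hh i)).
Qed.

Lemma Dirac_vec_mul_monogenic (l : R) p u :
  differentiable p u -> Dirac p u = 0 -> 'D_u p u = l *: p u ->
  Dirac (fun z => vec z * p z) u = - ((m%:R + 2 * l) *: p u).
Proof.
move=> hp h0 hE; apply: etrans (Dirac_vec_mul hp) _.
by rewrite h0 hE mulr0 subr0 scalerA -opprD -scalerDl.
Qed.

(** The identity D_u D_x (u f) = (m + 2 d - 2) D_x f + u D_u D_x f, where P i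
    stands for the i-th partial derivative of f in x.  Both Dirac operators of
    sums are expanded by Dirac_sum_e: on the left D (u P_i) = - (m + 2 d) P_i,
    and the divergence terms on the two sides differ by 2 sum_i e_i P_i. *)
Lemma Dirac_vec_family d (P : 'I_m -> 'rV[R]_m -> Cl R m) u :
  (forall i, monog d (P i)) ->
  Dirac (fun v => \sum_i e R i * (vec v * P i v)) u =
  (m%:R + 2 * d%:R - 2) *: (\sum_i e R i * P i u) +
  vec u * Dirac (fun v => \sum_i e R i * P i v) u.
Proof.
move=> hP.
have hd i := is_diff_deriveP (monog_diff (hP i) u).
have hv i := is_diff_clmul (is_diff_vec (is_diff_id u)) (hd i).
have hz : \sum_i e R i * Dirac (P i) u = 0.
  by apply: big1 => i _; rewrite (monog_Dirac (hP i)) mulr0.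
have hs : \sum_i e R i * Dirac (fun v => vec v * P i v) u =
    - ((m%:R + 2 * d%:R) *: \sum_i e R i * P i u).
  rewrite scaler_sumr -sumrN; apply: eq_bigr => i _.
  rewrite (Dirac_vec_mul_monogenic (monog_diff (hP i) u)
             (monog_Dirac (hP i) u) (monog_euler (hP i) u)).
  by rewrite mulrN scalerAr.
apply: etrans (Dirac_sum_e hv) _; rewrite (Dirac_sum_e hd) hs hz.
rewrite opprK oppr0 add0r big_split /= -mulr_sumr.
under [X in _ - 2 *: (_ + X)]eq_bigr do rewrite vec_bvec.
by rewrite mulrN -scalerAr scalerBl scalerDr opprD addrCA addrC.
Qed.

(** Partial derivatives commute, and D p = 0 identically. *)
Lemma Dirac_derive_monogenic d p a u : hpoly d p ->
  (forall v, Dirac p v = 0) -> Dirac (fun z => 'D_a p z) u = 0.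
Proof.
move=> /hpoly_calculusP hp h0.
have h i := is_diff_deriveP (hpoly_diff_derive hp (bvec R i) u).
transitivity ('D_a (fun z => \sum_i e R i * 'D_(bvec R i) p z) u); last first.
  rewrite (_ : (fun z => _) = cst 0) ?derive_cst //; apply/funext => v.
  exact: h0.
apply: etrans (esym (is_diff_derive a (is_diff_sum_e h))).
apply: eq_bigr => i _.
exact: (f_equal ( *%R (e R i)) (hpoly_derive_comm hp a (bvec R i) u)).
Qed.

End DiracFamilies.

(** * The reflection w |-> y w y / |y|^2 *)

Section Reflection.
Variables (R : realType) (m : nat).
Implicit Types (a b u v w x y : 'rV[R]_m) (p q : 'rV[R]_m -> Cl R m).

(** The formula w - 2 <y, w> y / |y|^2, with the factor 1 / |y|^2 kept outside
    so that it also holds at y = 0, where both sides vanish. *)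
Lemma sandwichE y w : sandwich y w =
  (dotp y y)^-1 *: ((- 2 * dotp y w) *: y + dotp y y *: w).
Proof.
apply: (can_inj (@vpartK R m)); rewrite vec_sandwich enorm_sqr vecZ.
congr (_ *: _); rewrite vecD !vecZ vec_swap mulrBl (mulNr _ (vec y)) -mulrA vec_sqr.
by rewrite enorm_sqr mulr_algl mulr_algr scaleNr opprK addrC -scaleNr mulNr.
Qed.

Lemma dotpDr u v w : dotp u (v + w) = dotp u v + dotp u w.
Proof. by rewrite -big_split; apply: eq_bigr => i _; rewrite mxE mulrDr. Qed.

Lemma dotpZr (l : R) u v : dotp u (l *: v) = l * dotp u v.
Proof. by rewrite mulr_sumr; apply: eq_bigr => i _; rewrite mxE mulrCA. Qed.

Lemma sandwich_linear y : linear (sandwich y).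
Proof.
move=> l u v; rewrite !sandwichE dotpDr dotpZr.
by apply/rowP => i; rewrite !mxE; ring.
Qed.

Lemma sandwich_sym y i j : sandwich y (bvec R i) 0 j = sandwich y (bvec R j) 0 i.
Proof.
rewrite !sandwichE !mxE !dotp_bvec eqxx /= eq_sym.
by congr (_ * (_ + _)); rewrite -!mulrA; congr (_ * _); rewrite mulrC.
Qed.

Lemma sandwichK y : y != 0 -> involutive (sandwich y).
Proof.
rewrite -dotp_eq0 => ny w; rewrite !sandwichE dotpZr dotpDr !dotpZr.
apply/rowP => i; rewrite !mxE; field.
exact: ny.
Qed.

Lemma vec_reflect y v : y != 0 ->
  vec v * vec y = - (vec y * vec (sandwich y v)).
Proof.
rewrite -dotp_eq0 => ny; rewrite vec_sandwich enorm_sqr -scalerAr !mulrA.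
rewrite vec_sqr enorm_sqr -!scalerAl mul1r scalerA mulrN mulVf //.
by rewrite scaleN1r opprK.
Qed.

(** A symmetric involution is orthogonal, and the operator sum_i e_i Phi(e_i)
    does not depend on the choice of the orthonormal basis. *)
Lemma sum_reflect y (Phi : 'rV[R]_m -> Cl R m) : y != 0 -> linear Phi ->
  \sum_i vec (sandwich y (bvec R i)) * Phi (sandwich y (bvec R i)) =
  \sum_i e R i * Phi (bvec R i).
Proof.
move=> ny hP; rewrite /vec; under eq_bigr do rewrite mulr_suml.
rewrite exchange_big; apply: eq_bigr => j _ /=.
pose mP := GRing.isLinear.Build _ _ _ _ _ hP.
pose P : {linear 'rV[R]_m -> Cl R m} := HB.pack Phi mP.
rewrite -[in RHS](sandwichK ny (bvec R j)).
rewrite (linear_sum_bvec (sandwich y (bvec R j)) (sandwich_linear y)).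
rewrite -[Phi]/(P : _ -> _) linear_sum mulr_sumr; apply: eq_bigr => i _.
by rewrite linearZ /= -scalerAl -scalerAr sandwich_sym.
Qed.

Lemma sum_e_reflect y (Psi : 'rV[R]_m -> Cl R m) : y != 0 ->
  \sum_i e R i * (vec y * Psi (bvec R i)) =
  - (vec y * \sum_i vec (sandwich y (bvec R i)) * Psi (bvec R i)).
Proof.
move=> ny; rewrite mulr_sumr -sumrN; apply: eq_bigr => i _.
by rewrite mulrA -vec_bvec (vec_reflect _ ny) mulNr mulrA.
Qed.

Lemma is_diff_lin (W : normedModType R) (S : 'rV[R]_m -> W) u :
  linear S -> is_diff u S S.
Proof.
move=> lS; rewrite (_ : S = fun v => \sum_i v 0 i *: S (bvec R i)).
  apply: is_diff_sum => i.
  have := is_diff_scale (is_diff_coord i u) (is_diff_cst (S (bvec R i)) u).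
  by move/is_diff_eq; apply; apply/funext => v; rewrite scaler0 add0r.
by apply/funext => v; exact: linear_sum_bvec.
Qed.

(** Moving y across the e_i reflects them, which is exactly what the chain
    rule for h (R v) does to the derivatives. *)
Lemma Dirac_reflect (h : 'rV[R]_m -> Cl R m) y w : y != 0 ->
  differentiable h (sandwich y w) ->
  Dirac (fun v => vec y * h (sandwich y v)) w =
  - (vec y * Dirac h (sandwich y w)).
Proof.
move=> ny /is_diff_deriveP hh.
have hS := is_diff_comp (is_diff_lin w (sandwich_linear y)) hh.
apply: etrans (Dirac_is_diff (is_diff_lmul (vec y) hS)) _.
apply: etrans (sum_e_reflect _ ny) _; congr (- (_ * _)).
exact: (sum_reflect ny (is_diff_linear hh)).
Qed.

End Reflection.

(** * Differentials of the inversion *)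

Section InversionDifferentials.
Variables (R : realType) (m : nat).
Implicit Types (a b u v w x y z : 'rV[R]_m) (p q : 'rV[R]_m -> Cl R m).

Lemma is_diff_dotp (V : normedModType R) (f df g dg : V -> 'rV[R]_m) (t : V) :
  is_diff t f df -> is_diff t g dg ->
  is_diff t (fun s => dotp (f s) (g s))
    (fun ds => dotp (f t) (dg ds) + dotp (df ds) (g t)).
Proof.
move=> hf hg.
have hi i := is_diff_scale (is_diff_comp hf (is_diff_coord i (f t)))
                           (is_diff_comp hg (is_diff_coord i (g t))).
have := is_diff_sum (index_enum 'I_m) hi.
move/is_diff_eq; apply; apply/funext => ds.
by rewrite big_split.
Qed.

Lemma is_diff_inv (V : normedModType R) (k dk : V -> R) (t : V) :
  is_diff t k dk -> k t != 0 ->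
  is_diff t (fun s => (k s)^-1) (fun ds => - (k t) ^- 2 * dk ds).
Proof.
move=> [hk <-] nk; apply: DiffDef; first exact: differentiableV.
by rewrite (diffV hk nk).
Qed.

Lemma is_diff_dotp_id y : is_diff y (fun z => dotp z z) (fun v => 2 * dotp y v).
Proof.
have := is_diff_dotp (is_diff_id y) (is_diff_id y).
move/is_diff_eq; apply; apply/funext => v.
by rewrite [X in _ + X]dotpC mulr_natl mulr2n.
Qed.

Lemma enorm_gt0 y : y != 0 -> 0 < enorm y.
Proof. by move=> ny; rewrite sqrtr_gt0 lt_neqAle dotp_ge0 andbT eq_sym dotp_eq0. Qed.

Lemma is_diff_enorm y : y != 0 ->
  is_diff y (@enorm R m) (fun v => dotp y v / enorm y).
Proof.
move=> ny.
have ry : 0 < dotp y y by rewrite lt_neqAle dotp_ge0 andbT eq_sym dotp_eq0.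
have hs : is_diff (dotp y y) Num.sqrt (fun t => t * (2 * enorm y)^-1).
  have [d1 d2] := is_derive1_sqrt ry.
  apply: DiffDef; first exact/derivable1_diffP.
  by rewrite (deriv1E d1) derive1E d2.
have := is_diff_comp (is_diff_dotp_id y) hs.
move/is_diff_eq; apply; apply/funext => v /=.
by field; exact: lt0r_neq0 (enorm_gt0 ny).
Qed.

Lemma is_diff_enormV n y : (0 < n)%N -> y != 0 ->
  is_diff y (fun z => (enorm z ^+ n)^-1)
    (fun v => - (n%:R * dotp y v / enorm y ^+ n / dotp y y)).
Proof.
case: n => // n _ ny; have N0 := lt0r_neq0 (enorm_gt0 ny).
have hX : is_diff y (fun z => enorm z ^+ n.+1)
    (fun v => (n.+1%:R * enorm y ^+ n) * (dotp y v / enorm y)).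
  rewrite (_ : (fun z => _) = (@enorm R m) ^+ n.+1); last first.
    by apply/funext => z; rewrite exprfctE.
  exact: (is_diffX n (is_diff_enorm ny)).
have hV := is_diff_inv hX (expf_neq0 n.+1 N0).
apply: (is_diff_eq hV); apply/funext => v.
rewrite -enorm_sqr !exprS expr0 mulr1; have NX := expf_neq0 n N0.
by field; rewrite N0 NX.
Qed.

Lemma is_diff_G y : (0 < m)%N -> y != 0 ->
  is_diff y (@G R m) (fun v => (enorm y ^+ m)^-1 *: vec v -
     (m%:R * dotp y v / enorm y ^+ m / dotp y y) *: vec y).
Proof.
move=> hm ny.
have := is_diff_scale (is_diff_enormV hm ny) (is_diff_vec (is_diff_id y)).
by move/is_diff_eq; apply; apply/funext => v /=; rewrite scaleNr.
Qed.

(** G is, up to a constant, the fundamental solution of D: the terms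
    sum_i e_i e_i = - m and m y y / |y|^2 = - m cancel. *)
Lemma Dirac_G y : (0 < m)%N -> y != 0 -> Dirac (@G R m) y = 0.
Proof.
move=> hm ny; apply: etrans (Dirac_is_diff (is_diff_G hm ny)) _.
have r0 : dotp y y != 0 by rewrite dotp_eq0.
set c := (enorm y ^+ m)^-1.
rewrite (eq_bigr (fun i => - c *: (1 : Cl R m) -
   (m%:R * c / dotp y y) *: ((y 0 i *: e R i) * vec y))); last first.
  move=> i _; rewrite mulrBr -!scalerAr vec_bvec e_sqr scalerN scaleNr.
  congr (- _ - _); rewrite -(scalerAl (y 0 i)) scalerA; congr (_ *: _).
  by rewrite dotp_bvec -/c; ring.
rewrite sumrB sumr_const card_ord -scaler_sumr -mulr_suml -/(vec y) vec_sqr.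
rewrite enorm_sqr scalerA -scaler_nat scalerA -scalerBl.
rewrite (_ : _ - _ = 0) ?scale0r //.
by field.
Qed.

(** The inversion is anticonformal: its differential is - 1 / |y|^2 times the
    reflection. *)
Lemma is_diff_vinv y : y != 0 ->
  is_diff y (@vinv R m) (fun v => - (dotp y y)^-1 *: sandwich y v).
Proof.
move=> ny; have r0 : dotp y y != 0 by rewrite dotp_eq0.
have h1 := is_diff_zscale (-1) (is_diff_inv (is_diff_dotp_id y) r0).
have h2 := is_diff_scale h1 (is_diff_id y).
rewrite (_ : @vinv R m = fun z => (-1 *: (dotp z z)^-1) *: z); last first.
  by apply/funext => z; rewrite /vinv enorm_sqr scaleN1r.
apply: (is_diff_eq h2); apply/funext => v.
rewrite sandwichE; apply/rowP => i; rewrite !mxE /GRing.scale /=.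
by field.
Qed.

Lemma is_diff_sandwich y w : y != 0 ->
  is_diff y ((@sandwich R m)^~ w) (fun v => (- 2 / dotp y y) *:
    (dotp v w *: y + dotp y w *: sandwich y v)).
Proof.
move=> ny; have r0 : dotp y y != 0 by rewrite dotp_eq0.
have h1 := is_diff_zscale (- 2) (is_diff_dotp (is_diff_id y) (is_diff_cst w y)).
have h2 := is_diff_scale h1 (is_diff_id y).
have h3 := is_diff_scale (is_diff_dotp_id y) (is_diff_cst w y).
have h4 := is_diff_scale (is_diff_inv (is_diff_dotp_id y) r0) (is_diff_add h2 h3).
rewrite (_ : (@sandwich R m)^~ w = (fun z => (dotp z z)^-1 *:
  ((- 2 * dotp z w) *: z + dotp z z *: w))); last first.
  by apply/funext => z; rewrite sandwichE.
apply: (is_diff_eq h4); apply/funext => v.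
rewrite sandwichE /cst /GRing.zero /=.
have -> : dotp y (0 : 'rV[R]_m) = 0.
  by rewrite /dotp big1 // => i _; rewrite mxE mulr0.
by apply/rowP => i; rewrite !mxE /GRing.scale /=; field.
Qed.

End InversionDifferentials.

(** * The Kelvin transform *)

Section Partial.
Variables (R : realType).

Lemma is_diff_partial (V1 V2 W : normedModType R) (f : V1 -> V2 -> W)
    (x : V1) (u : V2) :
  differentiable (fun s => f s.1 s.2) (x, u) ->
  [/\ differentiable (f^~ u) x, differentiable (f x) u &
    is_diff (x, u) (fun s => f s.1 s.2)
      (fun d => 'D_d.1 (f^~ u) x + 'D_d.2 (f x) u)].
Proof.
move=> df; have hf := differentiableP df.
set D := 'd _ _ in hf.
have h1 : is_diff x (f^~ u) (fun a => D (a, 0)).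
  have hp := is_diff_pair (is_diff_id x) (is_diff_cst u x).
  exact: (@is_diff_comp _ _ _ _ _ _ _ _ _ hp hf).
have h2 : is_diff u (f x) (fun b => D (0, b)).
  have hp := is_diff_pair (is_diff_cst x u) (is_diff_id u).
  exact: (@is_diff_comp _ _ _ _ _ _ _ _ _ hp hf).
split; [by case: h1|by case: h2|].
apply: (is_diff_eq hf); apply/funext => -[a b] /=.
rewrite (is_diff_derive a h1) (is_diff_derive b h2) -linearD /=.
by congr (D _); congr (_, _); rewrite ?addr0 ?add0r.
Qed.

End Partial.

Section Kelvin.
Variables (R : realType) (m : nat).
Implicit Types (a b u v w x y z : 'rV[R]_m) (p q : 'rV[R]_m -> Cl R m).

(** The Kelvin transform attached to the conformal weight of the Dirac
    operator and the reflection of the polynomial variable. *)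
Definition kelvin (f : 'rV[R]_m -> 'rV[R]_m -> Cl R m) z v : Cl R m :=
  G z * f (vinv z) (sandwich z v).

Lemma vec0 : vec (0 : 'rV[R]_m) = 0.
Proof. by rewrite /vec big1 // => i _; rewrite mxE scale0r. Qed.

Lemma vec_sum (I : Type) (r : seq I) (F : I -> 'rV[R]_m) :
  vec (\sum_(i <- r) F i) = \sum_(i <- r) vec (F i).
Proof. by rewrite (big_morph _ (@vecD R m) vec0). Qed.

(** Since y y is scalar, G z (z v z) / |z|^2 reduces to - v G z; so the Kelvin
    transform intertwines, up to sign, the multiplication by u and by w. *)
Lemma G_vec_sandwich z v : G z * vec (sandwich z v) = - (vec v * G z).
Proof.
have [->|nz] := eqVneq z 0.
  by rewrite /G vec0 scaler0 mul0r mulr0 oppr0.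
by rewrite /G -scalerAl -scalerAr (vec_reflect v nz) scalerN opprK.
Qed.

Lemma is_diff_kelvin f y w : (0 < m)%N -> y != 0 ->
  differentiable (fun s => f s.1 s.2) (vinv y, sandwich y w) ->
  is_diff y ((kelvin f)^~ w) (fun v =>
    G y * ('D_(- (dotp y y)^-1 *: sandwich y v) (f^~ (sandwich y w)) (vinv y) +
      'D_((- 2 / dotp y y) *: (dotp v w *: y + dotp y w *: sandwich y v))
         (f (vinv y)) (sandwich y w)) +
    ((enorm y ^+ m)^-1 *: vec v -
      (m%:R * dotp y v / enorm y ^+ m / dotp y y) *: vec y) *
    f (vinv y) (sandwich y w)).
Proof.
move=> hm ny hf; have [_ _ hF] := is_diff_partial hf.
have hp := is_diff_pair (is_diff_vinv ny) (is_diff_sandwich w ny).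
have hc := @is_diff_comp _ _ _ _ _ _ _ _ _ hp hF.
exact: (is_diff_clmul (is_diff_G hm ny) hc).
Qed.

(** With phi and psi the partial differentials of f in x and u, and
    r = 1 / |y|^2, the second factor is the derivative of f (y^-1, R w) in the
    direction e_i.  The hypothesis on psi says that f is monogenic in u; it
    removes the terms with the factor <y, w>. *)
Lemma sum_reflect_kelvin (r : R) y w (phi psi : 'rV[R]_m -> Cl R m) :
  y != 0 -> linear phi -> linear psi -> \sum_i e R i * psi (bvec R i) = 0 ->
  \sum_i vec (sandwich y (bvec R i)) * (- r *: phi (sandwich y (bvec R i)) +
     (- 2 * r) *: (dotp (bvec R i) w *: psi y +
                   dotp y w *: psi (sandwich y (bvec R i)))) =
  - (r *: (\sum_i e R i * phi (bvec R i) +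
           2 *: (vec (sandwich y w) * psi y))).
Proof.
move=> ny l1 l2 h0.
have s3 : \sum_i dotp (bvec R i) w *: vec (sandwich y (bvec R i)) =
    vec (sandwich y w).
  rewrite (linear_sum_bvec w (sandwich_linear y)) vec_sum.
  by apply: eq_bigr => i _; rewrite vecZ dotpC dotp_bvec.
have alg (t d : R) (A X Y Z : Cl R m) :
    A * (- r *: X + (- 2 * r) *: (t *: Y + d *: Z)) =
    - r *: (A * X) + (- 2 * r) *: ((t *: A) * Y) + (- 2 * r * d) *: (A * Z).
  rewrite mulrDr -!scalerAr mulrDr scalerDr addrA -!scalerAr.
  by rewrite -(scalerA _ d) -(scalerAl t).
rewrite (eq_bigr _ (fun i _ => alg _ _ _ _ _ _)) !big_split /= -!scaler_sumr.
rewrite -mulr_suml (sum_reflect ny l1) (sum_reflect ny l2) s3 h0 scaler0 addr0.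
by rewrite mulNr !scaleNr -opprD scalerDr scalerA [in RHS]mulrC.
Qed.

(** D G = 0 leaves the derivatives of f (y^-1, R w); moving y to the left
    reflects the e_i, and sum_reflect_kelvin evaluates the sum. *)
Lemma Dirac_kelvin f y w : (0 < m)%N -> y != 0 ->
  differentiable (fun s => f s.1 s.2) (vinv y, sandwich y w) ->
  Dirac (f (vinv y)) (sandwich y w) = 0 ->
  Dirac ((kelvin f)^~ w) y = ((enorm y ^+ m)^-1 / dotp y y) *:
    (vec y * (Dirac (f^~ (sandwich y w)) (vinv y) +
       2 *: (vec (sandwich y w) * 'D_y (f (vinv y)) (sandwich y w)))).
Proof.
move=> hm ny hf hu; have r0 : dotp y y != 0 by rewrite dotp_eq0.
apply: etrans (Dirac_is_diff (is_diff_kelvin hm ny hf)) _.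
have [/is_diff_deriveP/is_diff_linear l1 /is_diff_deriveP/is_diff_linear l2 _] :=
  is_diff_partial hf.
set x := vinv y in l1 l2 hu *; set u := sandwich y w in l1 l2 hu *.
set phi := (fun a => 'D_a (f^~ u) x) in l1; set psi := (fun b => 'D_b (f x) u) in l2.
pose mphi := GRing.isLinear.Build _ _ _ _ _ l1.
pose Lphi : {linear 'rV[R]_m -> Cl R m} := HB.pack phi mphi.
pose mpsi := GRing.isLinear.Build _ _ _ _ _ l2.
pose Lpsi : {linear 'rV[R]_m -> Cl R m} := HB.pack psi mpsi.
pose r := (dotp y y)^-1; pose c := (enorm y ^+ m)^-1.
have hphi a : phi (- r *: a) = - r *: phi a by rewrite -[phi]/(Lphi : _ -> _) linearZ.
have hpsi (r1 r2 r3 : R) a b :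
    psi (r1 *: (r2 *: a + r3 *: b)) = r1 *: (r2 *: psi a + r3 *: psi b).
  by rewrite -[psi]/(Lpsi : _ -> _) linearZ linearD !linearZ.
pose T v : Cl R m := - r *: phi (sandwich y v) +
  (- 2 * r) *: (dotp v w *: psi y + dotp y w *: psi (sandwich y v)).
transitivity (\sum_i (c *: (e R i * (vec y * T (bvec R i))) +
   (e R i * (c *: vec (bvec R i) -
      (m%:R * dotp y (bvec R i) / enorm y ^+ m / dotp y y) *: vec y)) * f x u)).
  apply: eq_bigr => i _; rewrite mulrDr mulrA; congr (_ + _).
    rewrite /G -scalerAr -scalerAl mulrA; congr (_ *: (_ * _)).
    by rewrite -[X in X + _]/(phi _) -[X in _ + X]/(psi _) hphi hpsi.
  by rewrite mulrA.
rewrite big_split /= -mulr_suml.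
have -> : \sum_i e R i * (c *: vec (bvec R i) -
      (m%:R * dotp y (bvec R i) / enorm y ^+ m / dotp y y) *: vec y) = 0.
  by apply: etrans (esym (Dirac_is_diff (is_diff_G hm ny))) (Dirac_G hm ny).
rewrite mul0r addr0 -scaler_sumr (sum_e_reflect T ny) -scalerA; congr (_ *: _).
rewrite scalerAr -mulrN; congr (_ * _).
apply: etrans (congr1 -%R (sum_reflect_kelvin r w ny l1 l2 hu)) _.
exact: opprK.
Qed.

End Kelvin.

(** * The Rarita-Schwinger operator and its conformal invariance *)

Section RaritaSchwinger.
Variables (R : realType) (m d : nat).
Implicit Types (a b u v w x y z : 'rV[R]_m) (f : 'rV[R]_m -> 'rV[R]_m -> Cl R m).

Local Notation c_md := (m%:R + 2 * d%:R - 2 : R).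

(** For f with values in the monogenic polynomials of degree d, this is
    m + 2 d - 2 times the projection of D_x f onto those polynomials, that is,
    a multiple of the classical Rarita-Schwinger operator. *)
Definition rarita_schwinger f x u : Cl R m :=
  c_md *: Dirac (f^~ u) x + vec u * Dirac (fun v => Dirac (f^~ v) x) u.

(** Monogenicity is required near x, not only at x, because it has to be
    differentiated in the first variable. *)
Definition monogenic_near f x : Prop :=
  (\forall z \near x, hpoly d (f z) /\ forall u, Dirac (f z) u = 0) /\
  (forall u, differentiable (f^~ u) x).

(** The scalar l serves for l = 1 and for the sign l = - 1 that the Kelvin
    transform produces. *)
Lemma Dirac_Dirac_vec (l : R) f x u : monogenic_near f x ->
  Dirac (fun v => Dirac (fun z => l *: (vec v * f z v)) x) u = l *: rarita_schwinger f x u.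
Proof.
move=> [hf hd]; pose P i v := 'D_(bvec R i) (f^~ v) x.
have hP i : monog d (P i) by exact: monog_derive.
have hdP i := is_diff_clmul (is_diff_vec (is_diff_id u))
                            (is_diff_deriveP (monog_diff (hP i) u)).
have hF := is_diff_sum_e hdP.
have -> : (fun v => Dirac (fun z => l *: (vec v * f z v)) x) =
    fun v => l *: \sum_i e R i * (vec v * P i v).
  apply/funext => v; have hv := is_diff_lmul (vec v) (is_diff_deriveP (hd v)).
  apply: etrans (Dirac_is_diff (is_diff_zscale l hv)) _.
  by rewrite scaler_sumr; apply: eq_bigr => i _; rewrite -scalerAr.
apply: etrans (Dirac_is_diff (is_diff_zscale l hF)) _.
under eq_bigr do rewrite -scalerAr.
rewrite -scaler_sumr; apply: (congr1 ( *:%R l)).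
apply: etrans (esym (Dirac_is_diff hF)) _.
exact: (Dirac_vec_family u hP).
Qed.

Lemma Qk_scale_vec (l : R) k f x u : monogenic_near f x ->
  Qk k (fun z v => l *: (vec v * f z v)) x u =
  - ((m%:R + 2 * k%:R - 2)^-1 *: (vec u * (l *: rarita_schwinger f x u))).
Proof. by move=> hf; rewrite QkE (Dirac_Dirac_vec l u hf). Qed.

Lemma differentiable_Dirac_param f x u : monogenic_near f x ->
  differentiable (fun v => Dirac (f^~ v) x) u.
Proof.
move=> [hf hd]; pose P i v := 'D_(bvec R i) (f^~ v) x.
have hP i : monog d (P i) by exact: monog_derive.
by case: (is_diff_sum_e (fun i => is_diff_deriveP (monog_diff (hP i) u))).
Qed.

Lemma monogenic_near_kelvin f y : (0 < m)%N -> y != 0 ->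
  (\forall x \near vinv y, hpoly d (f x) /\ forall u, Dirac (f x) u = 0) ->
  (forall u, differentiable (fun s => f s.1 s.2) (vinv y, u)) ->
  monogenic_near (kelvin f) y.
Proof.
move=> hm ny hf hd; split=> [|w]; last by case: (is_diff_kelvin hm ny (hd (sandwich y w))).
have cv : {for y, continuous (@vinv R m)}.
  by apply: differentiable_continuous; case: (is_diff_vinv ny).
have nz : \forall z \near y, z != 0.
  have cd : {for y, continuous (fun z => dotp z z)}.
    by apply: differentiable_continuous; case: (is_diff_dotp_id y).
  have r0 : dotp y y != 0 by rewrite dotp_eq0.
  have nd : \forall z \near y, dotp z z != 0 by exact: (cvgr_neq0 _ cd r0).
  by near=> z; rewrite -dotp_eq0; near: z.
have hv : \forall z \near y, hpoly d (f (vinv z)) /\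
    forall u, Dirac (f (vinv z)) u = 0 := cv _ hf.
apply: filterS2 nz hv => z zN0 [hz h0]; split.
  by apply: hpolyMl; apply: hpoly_lin (sandwich_linear z) hz.
move=> u.
have hz' := hpoly_diff (hpoly_calculusP hz) (sandwich z u).
have hS := is_diff_comp (is_diff_lin u (sandwich_linear z)) (is_diff_deriveP hz').
have hyS := is_diff_lmul (vec z) hS.
have E : kelvin f z = fun v => (enorm z ^+ m)^-1 *: (vec z * f (vinv z) (sandwich z v)).
  by apply/funext => v; rewrite /kelvin /G -scalerAl.
rewrite E; apply: etrans (Dirac_is_diff (is_diff_zscale _ hyS)) _.
under eq_bigr do rewrite -scalerAr.
rewrite -scaler_sumr; apply: etrans (_ : _ *: (- (vec z * 0)) = 0); last first.
  by rewrite mulr0 oppr0 scaler0.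
apply: (congr1 ( *:%R _)); apply: etrans (esym (Dirac_is_diff hyS)) _.
by apply: etrans (Dirac_reflect zN0 hz') _; rewrite h0.
Unshelve. all: by end_near. Qed.

(** Put q = <y, d_u> f and h = D_x f + 2 u q, so that D_y g = k y h(R w) by
    Dirac_kelvin.  As q is monogenic of degree d - 1,
    D_u h = D_u D_x f - 2 (m + 2 d - 2) q, and Dirac_reflect gives D_w D_y g.
    The terms in q then cancel because w y = - y (R w). *)
Lemma rarita_schwinger_kelvin f y w : (0 < m)%N -> y != 0 ->
  (\forall x \near vinv y, hpoly d (f x) /\ forall u, Dirac (f x) u = 0) ->
  (forall u, differentiable (fun s => f s.1 s.2) (vinv y, u)) ->
  rarita_schwinger (kelvin f) y w = ((enorm y ^+ m)^-1 / dotp y y) *: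
    (vec y * rarita_schwinger f (vinv y) (sandwich y w)).
Proof.
move=> hm ny hf hd; set k := _ / _; set x := vinv y in hf hd *.
have [hp h0] := nbhs_singleton hf.
have hx : monogenic_near f x by split=> // u; case: (is_diff_partial (hd u)).
pose q v := 'D_y (f x) v.
pose h v := Dirac (f^~ v) x + 2 *: (vec v * q v).
have hK v : Dirac ((kelvin f)^~ v) y = k *: (vec y * h (sandwich y v)).
  exact: Dirac_kelvin hm ny (hd _) (h0 _).
set u := sandwich y w.
have dP := is_diff_deriveP (differentiable_Dirac_param u hx).
have dq : differentiable q u by exact: (hpoly_diff_derive (hpoly_calculusP hp) y u).
have dvq := is_diff_clmul (is_diff_vec (is_diff_id u)) (is_diff_deriveP dq).
have dh := is_diff_add dP (is_diff_zscale 2 dvq).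
have Dh : Dirac h u = Dirac (fun v => Dirac (f^~ v) x) u - (2 * c_md) *: q u.
  apply: etrans (Dirac_is_diff dh) _.
  under eq_bigr do rewrite mulrDr -scalerAr.
  rewrite big_split /= -scaler_sumr; congr (_ + _).
  have hq0 : Dirac q u = 0 by exact: (Dirac_derive_monogenic y u hp h0).
  have hqE := hpoly_derive_euler (hpoly_calculusP hp) y u.
  rewrite -(Dirac_is_diff dvq) (Dirac_vec_mul_monogenic dq hq0 hqE).
  rewrite scalerN scalerA; congr (- (_ *: _)); ring.
have DK : Dirac (fun v => Dirac ((kelvin f)^~ v) y) w =
    - k *: (vec y * Dirac h u).
  rewrite (funext hK).
  have hhu : differentiable h u by case: dh.
  have hS := is_diff_comp (is_diff_lin w (sandwich_linear y)) (is_diff_deriveP hhu).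
  have hyS := is_diff_lmul (vec y) hS.
  apply: etrans (Dirac_is_diff (is_diff_zscale k hyS)) _.
  under eq_bigr do rewrite -scalerAr.
  rewrite -scaler_sumr scaleNr -scalerN; apply: (congr1 ( *:%R k)).
  by apply: etrans (esym (Dirac_is_diff hyS)) _; exact: Dirac_reflect.
rewrite /rarita_schwinger hK DK Dh.
have alg (n l : R) (Y S W D E Q : Cl R m) : W * Y = - (Y * S) ->
    n *: (l *: (Y * (D + 2 *: (S * Q)))) + W * (- l *: (Y * (E - (2 * n) *: Q))) =
    l *: (Y * (n *: D + S * E)).
  move=> hWY; rewrite -(scalerAr (- l) W) (mulrA W) hWY mulNr scaleNr scalerN.
  rewrite opprK -(mulrA Y) (scalerA n) (mulrC n) -(scalerA l) -scalerDr.
  congr (l *: _); rewrite scalerAr -mulrDr; congr (Y * _).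
  rewrite scalerDr scalerA (mulrC n) mulrBr -scalerAr -addrA.
  by congr (_ + _); rewrite addrCA subrr addr0.
exact: alg (vec_reflect w ny).
Qed.

End RaritaSchwinger.

Theorem theorem7 (R : realType) (m k : nat) (U : set 'rV[R]_m)
    (f : 'rV[R]_m -> 'rV[R]_m -> Cl R m)
    (hm : (3 <= m)%N) (hk : (1 <= k)%N)
    (hU : is_domain U)
    (hf : C1_on (U `*` [set: 'rV[R]_m]) (fun p => f p.1 p.2))
    (hM : forall x, U x -> Mk (k - 1) (f x))
    (hQ : forall x u, U x -> Qk k (fun x u => vec u * f x u) x u = 0) :
  forall y w : 'rV[R]_m, y != 0 -> U (vinv y) ->
    Qk k (fun y w => G y * vec (sandwich y w) * f (vinv y) (sandwich y w)) y w = 0.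
Proof.
move=> y w ny Ux.
have m0 : (0 < m)%N by apply: leq_trans hm.
have [oU _ _] := hU.
pose d := (k - 1)%N.
have hn : \forall x \near vinv y, hpoly d (f x) /\ forall u, Dirac (f x) u = 0.
  have : \forall x \near vinv y, U x by exact: open_nbhs_nbhs.
  apply: filterS => x /hM [hp h0]; split=> //; exact: homog_poly_hpoly.
have hd u : differentiable (fun s => f s.1 s.2) (vinv y, u).
  by have [] := hf (vinv y, u) (conj Ux I).
have hx : monogenic_near d f (vinv y).
  by split=> // u; case: (is_diff_partial (hd u)).
have hy := monogenic_near_kelvin m0 ny hn hd.
have c0 : (m%:R + 2 * k%:R - 2 : R) != 0.
  by rewrite -natrM -natrD subr_eq0 (eqr_nat R _ 2); lia.
(* For w <> 0 the vector u is invertible, so the factor u in the hypothesis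
   can be cancelled. *)
have hw : vec w * rarita_schwinger d (kelvin f) y w = 0.
  have [->|nw] := eqVneq w 0; first by rewrite vec0 mul0r.
  rewrite (rarita_schwinger_kelvin w m0 ny hn hd); set u := sandwich y w.
  have nu : u != 0.
    apply: contra nw => /eqP u0; rewrite -(sandwichK ny w) -/u u0.
    rewrite (linear_sum_bvec 0 (sandwich_linear y)) big1 // => i _.
    by rewrite mxE scale0r.
  have := hQ (vinv y) u Ux.
  rewrite (_ : (fun x u => vec u * f x u) = fun x u => 1 *: (vec u * f x u)); last first.
    by apply/funext => x; apply/funext => v; rewrite scale1r.
  rewrite (Qk_scale_vec 1 k u hx) scale1r => /eqP.
  rewrite oppr_eq0 scaler_eq0 invr_eq0 (negbTE c0) => /= /eqP h0.
  have -> : rarita_schwinger d f (vinv y) u = 0.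
    by rewrite -[LHS]mul1r -(vinvP nu).2 -mulrA h0 mulr0.
  by rewrite mulr0 scaler0 mulr0.
rewrite (_ : (fun y w => _) = fun z v => -1 *: (vec v * kelvin f z v)); last first.
  apply/funext => z; apply/funext => v.
  by rewrite G_vec_sandwich scaleN1r /kelvin mulNr mulrA.
by rewrite (Qk_scale_vec (-1) k w hy) -scalerAr hw !scaler0 oppr0.
Qed.
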